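(* There is an absolute constant $C>0$ such that the following holds. For every positive integer $n$ and every $k\in\{2,\ldots,\lceil n/2\rceil\}$, the polynomial $$q_k(\mathbf{x})=\Big(\sum_{i=1}^n x_i-k\Big)\Big(\sum_{i=1}^n x_i-k+1\Big)$$ has a degree $d$ SoS certificate of nonnegativity over the Boolean hypercube, i.e. $q_k\in\Sigma^{\mathcal{H}}_{n,d}$, for some $d\le C\sqrt{nk}\log(n)$ (that is, the certificate has degree $O(\sqrt{nk}\log n)$).
   Context: For $n\in\mathbb{N}$, $\mathbb{R}[\mathbf{x}]$ denotes real polynomials in $x_1,\ldots,x_n$. $\Sigma_{n,d}$ is the set of finite sums $\sum_i s_i^2$ with $s_i\in\mathbb{R}[\mathbf{x}]$ and $\deg(s_i)\le d$. The Boolean axioms are $\mathcal{H}=\{\pm(x_i^2-x_i): i\in[n]\}$. For a finite set $\mathcal{G}\supseteq\mathcal{H}$ of polynomials, $\Sigma^{\mathcal{G}}_{n,d}$ is the set of polynomials of the form $s_0+\sum_{i} s_i g_i$ (finite sum) with $g_i\in\mathcal{G}$, $s_i\in\Sigma_{n,d}$, and $s_0\in\Sigma_{n,2\lceil(2d+\deg(\mathcal{G}))/2\rceil}$, where $\deg(\mathcal{G})=\max\{\deg g: g\in\mathcal{G}\}$. A polynomial $f$ has a degree $d$ SoS certificate over the Boolean hypercube (is a degree $d$ SoS modulo the Boolean axioms) if $f\in\Sigma^{\mathcal{H}}_{n,d}$. *)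

(* Defs.v *)
From HB Require Import structures.
From mathcomp Require Import all_boot all_order all_algebra.
From mathcomp Require Import mpoly.
From mathcomp Require Import reals exp.

Set Implicit Arguments.
Unset Strict Implicit.
Unset Printing Implicit Defensive.

Import Order.TTheory GRing.Theory Num.Theory.
Local Open Scope ring_scope.

(* [msize p] is the total degree plus one, and [msize 0 = 0]; so deg 0 is
   taken to be 0 here. *)
Definition deg (R : realType) (n : nat) (p : {mpoly R[n]}) : nat :=
  (msize p).-1.

Definition SoS (R : realType) (n d : nat) (f : {mpoly R[n]}) : Prop :=
  exists s : seq {mpoly R[n]},
    (forall p, p \in s -> (deg p <= d)%N) /\ f = \sum_(p <- s) p ^+ 2.

Definition boolean_axioms (R : realType) (n : nat) : seq {mpoly R[n]} :=
  [seq 'X_i ^+ 2 - 'X_i | i : 'I_n] ++ [seq - ('X_i ^+ 2 - 'X_i) | i : 'I_n].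

(* A finite set of polynomials is represented by a sequence. *)
Definition degs (R : realType) (n : nat) (G : seq {mpoly R[n]}) : nat :=
  (\max_(g <- G) deg g)%N.

(* The sequence [t] lists the pairs (s_i, g_i); [(uphalf m).*2] is
   2 * ceil(m / 2). *)
Definition SoS_mod (R : realType) (n : nat) (G : seq {mpoly R[n]}) (d : nat)
    (f : {mpoly R[n]}) : Prop :=
  exists (s0 : {mpoly R[n]}) (t : seq ({mpoly R[n]} * {mpoly R[n]})),
    [/\ SoS (uphalf (2 * d + degs G)).*2 s0,
        forall u, u \in t -> SoS d u.1 /\ u.2 \in G
      & f = s0 + \sum_(u <- t) u.1 * u.2].

Definition has_SoS_certificate (R : realType) (n d : nat) (f : {mpoly R[n]}) :
    Prop :=
  SoS_mod (boolean_axioms R n) d f.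

Definition sos_q (R : realType) (n k : nat) : {mpoly R[n]} :=
  (\sum_(i < n) 'X_i - k%:R) * (\sum_(i < n) 'X_i - k%:R + 1).

(* Main.v *)
(** On the hypercube [S = x_1 + ... + x_n] takes the values 0, ..., n, and both
    the falling factorials S (S - 1) ... (S - m + 1) and n - S are sums of squares
    modulo the axioms.  Write q for the univariate polynomial (t - k) (t - k + 1).
    For each j <= k - 2, the Lagrange polynomial of the nodes 0, ..., k at j is
    multiplied by polynomials that equal 1 at j and are small away from j; this
    gives u_j, of size at most n^-2 on [k + 1, n].  Then q - sum_j q(j) u_j^2
    vanishes at 0, ..., k and is nonnegative on [k + 1, n], so it is
    t (t - 1) ... (t - k) r(t) with r nonnegative on [k + 1, n], and Lukács' theorem
    writes r in terms of squares, t - (k + 1) and n - t.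

    The Lagrange polynomial is at most n^(4 M) at distance M <= k from j.  A
    Chebyshev polynomial of degree about sqrt (n / l), raised to a power of order
    log n, damps by n^-5 beyond distance l; the product over l = 1, ..., k has
    degree O(sqrt (n k) log n). *)

Require Import Defs.
From mathcomp Require Import all_boot all_order all_algebra.
From mathcomp Require Import mpoly.
From mathcomp Require Import reals exp.
From mathcomp Require Import polyrcf ring lra zify.
From mathcomp Require derive.

Import Order.TTheory GRing.Theory Num.Theory.
Import normed_module.numFieldNormedType.Exports.
Local Open Scope ring_scope.

(** * Sums of squares modulo the Boolean axioms *)

Section BooleanSoS.
Variables (R : realType) (n : nat).
Implicit Types (p q f g : {mpoly R[n]}) (d e D : nat).

Lemma deg_leE p d : (deg p <= d)%N = (msize p <= d.+1)%N.
Proof. by rewrite /deg; case: (msize p). Qed.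

Lemma deg_leD p q d : (deg p <= d)%N -> (deg q <= d)%N -> (deg (p + q) <= d)%N.
Proof.
rewrite !deg_leE => hp hq; apply: leq_trans (mmeasureD_le _ _ _) _.
by rewrite geq_max hp.
Qed.

Lemma deg_leN p d : (deg (- p) <= d)%N = (deg p <= d)%N.
Proof. by rewrite /deg mmeasureN. Qed.

Lemma deg_leB p q d : (deg p <= d)%N -> (deg q <= d)%N -> (deg (p - q) <= d)%N.
Proof. by move=> hp hq; apply: deg_leD; rewrite ?deg_leN. Qed.

Lemma deg_leC (c : R) d : (deg (c%:MP_[n] : {mpoly R[n]}) <= d)%N.
Proof. by rewrite deg_leE mmeasureC; case: (_ != _). Qed.

Lemma deg_le1 d : (deg (1 : {mpoly R[n]}) <= d)%N.
Proof. by rewrite deg_leE msize1. Qed.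

Lemma deg_le_nat m d : (deg (m%:R : {mpoly R[n]}) <= d)%N.
Proof. by rewrite -mpolyC_nat; apply: deg_leC. Qed.

Lemma deg_leX (i : 'I_n) : (deg ('X_i : {mpoly R[n]}) <= 1)%N.
Proof. by rewrite deg_leE msizeX mdeg1. Qed.

Lemma deg_leM p q d e :
  (deg p <= d)%N -> (deg q <= e)%N -> (deg (p * q) <= d + e)%N.
Proof.
have [->|p0] := eqVneq p 0; first by rewrite mul0r /deg mmeasure0.
have [->|q0] := eqVneq q 0; first by rewrite mulr0 /deg mmeasure0.
rewrite /deg msizeM //; move: (mmeasure _ p) (mmeasure _ q) => a b; lia.
Qed.

Lemma deg_leZ (c : R) p d : (deg p <= d)%N -> (deg (c *: p) <= d)%N.
Proof. by rewrite !deg_leE; apply: leq_trans (msizeZ_le _ _). Qed.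

Lemma deg_leW p d e : (d <= e)%N -> (deg p <= d)%N -> (deg p <= e)%N.
Proof. by move=> de /leq_trans; apply. Qed.

Lemma deg_le_sum (I : eqType) (r : seq I) (F : I -> {mpoly R[n]}) d :
  (forall i, i \in r -> (deg (F i) <= d)%N) -> (deg (\sum_(i <- r) F i) <= d)%N.
Proof.
move=> h; rewrite big_seq; elim/big_ind: _ => //.
- by rewrite /deg mmeasure0.
- by move=> p q; apply: deg_leD.
Qed.

Lemma deg_le_prod (I : eqType) (r : seq I) (F : I -> {mpoly R[n]}) :
  (forall i, i \in r -> (deg (F i) <= 1)%N) ->
  (deg (\prod_(i <- r) F i) <= size r)%N.
Proof.
elim: r => [|i r IH] h; first by rewrite big_nil deg_le1.
rewrite big_cons /= -add1n; apply: deg_leM; first by apply: h; rewrite mem_head.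
by apply: IH => j jr; apply: h; rewrite inE jr orbT.
Qed.

(* Unlike in [has_SoS_certificate], the multipliers of the axioms are arbitrary
   polynomials, which makes the notion stable under the operations below. *)
Definition bool_sos D f := exists (s : seq {mpoly R[n]}) (h : 'I_n -> {mpoly R[n]}),
  [/\ forall p, p \in s -> (deg p <= D)%N,
      forall i, (deg (h i) <= 2 * D)%N &
      f = \sum_(p <- s) p ^+ 2 + \sum_i h i * ('X_i ^+ 2 - 'X_i)].

Lemma bool_sosW D e f : (D <= e)%N -> bool_sos D f -> bool_sos e f.
Proof.
move=> De [s [h [hs hh ->]]]; exists s, h; split => // [p ps|i].
- by apply: leq_trans (hs _ ps) De.
- by apply: leq_trans (hh i) _; rewrite leq_mul2l De orbT.
Qed.

Lemma bool_sos0 D : bool_sos D 0.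
Proof.
exists [::], (fun=> 0); split => // [i|]; first by rewrite /deg mmeasure0.
by rewrite big_nil add0r big1 // => i _; rewrite mul0r.
Qed.

Lemma bool_sosD D f g : bool_sos D f -> bool_sos D g -> bool_sos D (f + g).
Proof.
move=> [s [h [hs hh ->]]] [s' [h' [hs' hh' ->]]].
exists (s ++ s'), (fun i => h i + h' i); split.
- by move=> p; rewrite mem_cat => /orP[/hs|/hs'].
- by move=> i; apply: deg_leD.
- rewrite big_cat /=.
  have -> : \sum_i (h i + h' i) * ('X_i ^+ 2 - 'X_i) =
    \sum_i h i * ('X_i ^+ 2 - 'X_i) + \sum_i h' i * ('X_i ^+ 2 - 'X_i).
    by rewrite -big_split; apply: eq_bigr => i _; rewrite mulrDl.
  by ring.
Qed.

Lemma bool_sos_sum (I : eqType) (r : seq I) (F : I -> {mpoly R[n]}) D :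
  (forall i, i \in r -> bool_sos D (F i)) -> bool_sos D (\sum_(i <- r) F i).
Proof.
move=> h; rewrite big_seq; elim/big_ind: _ => //; first exact: bool_sos0.
by move=> f g; apply: bool_sosD.
Qed.

Lemma bool_sos_ideal D (i : 'I_n) g :
  (deg g <= 2 * D)%N -> bool_sos D (g * ('X_i ^+ 2 - 'X_i)).
Proof.
move=> dg; exists [::], (fun j => if j == i then g else 0); split => // [j|].
  by case: ifP => // _; rewrite /deg mmeasure0.
rewrite big_nil add0r (bigD1 i) //= eqxx big1 ?addr0 // => j /negPf ->.
by rewrite mul0r.
Qed.

Lemma bool_sosM2 D e f g : (deg g <= e)%N ->
  bool_sos D f -> bool_sos (D + e) (g ^+ 2 * f).
Proof.
move=> dg [s [h [hs hh ->]]].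
exists [seq g * p | p <- s], (fun i => g ^+ 2 * h i); split.
- by move=> _ /mapP[p ps ->]; rewrite addnC; apply: deg_leM; rewrite ?hs.
- move=> i; rewrite mulnDr addnC; apply: deg_leM => //.
  by rewrite expr2 mul2n -addnn deg_leM.
- rewrite mulrDr !mulr_sumr big_map; congr (_ + _).
  + by apply: eq_bigr => p _; rewrite exprMn.
  + by apply: eq_bigr => i _; rewrite mulrA.
Qed.

Lemma bool_sosX2 D g : (deg g <= D)%N -> bool_sos D (g ^+ 2).
Proof.
move=> dg; exists [:: g], (fun=> 0); split => [p|i|].
- by rewrite inE => /eqP ->.
- by rewrite /deg mmeasure0.
- by rewrite big_seq1 [X in _ + X]big1 ?addr0 // => i _; rewrite mul0r.
Qed.

Lemma bool_sosZ D f (c : R) : 0 <= c -> bool_sos D f -> bool_sos D (c *: f).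
Proof.
move=> c0 hf; rewrite -(sqr_sqrtr c0) -mul_mpolyC expr2 mpolyCM -expr2 -[D]addn0.
by apply: bool_sosM2 => //; apply: deg_leC.
Qed.

(** The identity h = ((h + 1) / 2)^2 - ((h - 1) / 2)^2 turns an arbitrary multiplier of an axiom
    into two square multipliers, one for each sign of the axiom. The polynomials being squared have
    the degree of h, up to 2 D, which is why D doubles. *)
Lemma bool_sos_certificate D f : bool_sos D f -> has_SoS_certificate (2 * D) f.
Proof.
move=> [s [h [hs hh ->]]].
pose c : R := 2^-1.
exists (\sum_(p <- s) p ^+ 2),
  ([seq ((c *: (h i + 1)) ^+ 2, 'X_i ^+ 2 - 'X_i) | i : 'I_n] ++
   [seq ((c *: (h i - 1)) ^+ 2, - ('X_i ^+ 2 - 'X_i)) | i : 'I_n]).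
split.
- exists s; split => // p ps; apply: leq_trans (hs _ ps) _; lia.
- have sq g : (deg g <= 2 * D)%N -> SoS (2 * D) (g ^+ 2).
    by exists [:: g]; split; [move=> p; rewrite inE => /eqP -> | rewrite big_seq1].
  move=> u; rewrite mem_cat => /orP[] /imageP[i _ ->] /=; split.
  + by apply: sq; apply: deg_leZ; apply: deg_leD => //; apply: deg_le1.
  + by rewrite mem_cat; apply/orP; left; apply/imageP; exists i.
  + by apply: sq; apply: deg_leZ; apply: deg_leB => //; apply: deg_le1.
  + by rewrite mem_cat; apply/orP; right; apply/imageP; exists i.
- congr (_ + _); rewrite big_cat /= !big_image /= -big_split /=.
  apply: eq_bigr => i _.
  have c4 : 4 * c%:MP ^+ 2 = 1 :> {mpoly R[n]}.
    by rewrite -mpolyC_nat expr2 -!mpolyCM -mpolyC1; congr _%:MP; rewrite /c; field.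
  by rewrite -!mul_mpolyC -[LHS]mul1r -[X in X * _ = _]c4; ring.
Qed.

Let S : {mpoly R[n]} := \sum_(i < n) 'X_i.

Lemma deg_le_sumX : (deg S <= 1)%N.
Proof. by apply: deg_le_sum => i _; apply: deg_leX. Qed.

Lemma natr_sub_sumX : n%:R - S = \sum_(i < n) (1 - 'X_i).
Proof. by rewrite sumrB sumr_const card_ord. Qed.

(** Each summand of n - S is a square modulo its axiom, 1 - x_i = (1 - x_i)^2 - (x_i^2 - x_i), so a
    product p^2 (1 - x_i) is ((1 - x_i) p)^2 up to a multiple of the axiom. *)
Lemma bool_sosM_compl D f : bool_sos D f -> bool_sos D.+1 (f * (n%:R - S)).
Proof.
move=> hf.
rewrite natr_sub_sumX mulr_sumr; apply: bool_sos_sum => i _.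
case: hf => [s [h [hs hh ->]]].
have -> : (\sum_(p <- s) p ^+ 2 + \sum_j h j * ('X_j ^+ 2 - 'X_j)) * (1 - 'X_i)
  = \sum_(p <- s) ((1 - 'X_i) * p) ^+ 2
    + (\sum_(p <- s) (- p ^+ 2 * ('X_i ^+ 2 - 'X_i))
    + \sum_j ((1 - 'X_i) * h j) * ('X_j ^+ 2 - 'X_j)).
  rewrite mulrDl addrA; congr (_ + _); last first.
    by rewrite mulr_suml; apply: eq_bigr => j _; ring.
  by rewrite mulr_suml -big_split; apply: eq_bigr => p _ /=; ring.
have d1 : (deg (1 - 'X_i : {mpoly R[n]}) <= 1)%N.
  by apply: deg_leB; rewrite ?deg_le1 ?deg_leX.
apply: bool_sosD; [|apply: bool_sosD]; apply: bool_sos_sum => j js.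
- by apply: bool_sosX2; rewrite -add1n deg_leM ?hs.
- apply: bool_sos_ideal; rewrite deg_leN.
  by apply: (@deg_leW _ (D + D)); [lia|rewrite expr2 deg_leM ?hs].
- apply: bool_sos_ideal; apply: (@deg_leW _ (1 + 2 * D)); first lia.
  by rewrite deg_leM.
Qed.

(* On the hypercube, multiplying by [S - #|A|] a monomial with support [A]
   amounts to summing its products with the variables outside [A]. *)
Lemma bool_sos_mon_ffact (A : {set 'I_n}) r :
  bool_sos (#|A| + r)
    ((\prod_(i in A) 'X_i) ^+ 2 * \prod_(m <- iota #|A| r) (S - m%:R)).
Proof.
elim: r A => [|r IH] A.
  rewrite addn0 big_nil mulr1; apply: bool_sosX2.
  rewrite -big_enum cardE; apply: deg_le_prod => i _; exact: deg_leX.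
rewrite /= big_cons.
set xA := \prod_(i in A) 'X_i; set F := \prod_(j <- _) _.
have dF : (deg F <= r)%N.
  rewrite -[r in (_ <= r)%N](size_iota #|A|.+1); apply: deg_le_prod => j _.
  by apply: deg_leB; rewrite ?deg_le_sumX ?deg_le_nat.
have dxA : (deg xA <= #|A|)%N.
  by rewrite /xA -big_enum cardE; apply: deg_le_prod => i _; exact: deg_leX.
have -> : xA ^+ 2 * ((S - #|A|%:R) * F) =
   \sum_(i | i \notin A) (xA * 'X_i) ^+ 2 * F
   + (\sum_(i | i \notin A) (- (xA ^+ 2 * F)) * ('X_i ^+ 2 - 'X_i)
   + \sum_(i in A) xA ^+ 2 * ('X_i - 1) * F).
  have -> : S - #|A|%:R = \sum_(i | i \notin A) 'X_i + \sum_(i in A) ('X_i - 1).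
    rewrite /S (bigID (mem A)) /= sumrB sumr_const; ring.
  rewrite mulrDl mulrDr !mulr_suml !mulr_sumr addrA; congr (_ + _); last first.
    by apply: eq_bigr => i _; ring.
  by rewrite -big_split; apply: eq_bigr => i _ /=; ring.
apply: bool_sosD; [|apply: bool_sosD].
- rewrite -big_filter; apply: bool_sos_sum => i; rewrite mem_filter => /andP[iA _].
  have := IH (i |: A); rewrite cardsU1 iA /= add1n addSnnS.
  by rewrite big_setU1 //= mulrC [_ * \prod_(_ in A) _]mulrC mulrC.
- rewrite -big_filter; apply: bool_sos_sum => i _; apply: bool_sos_ideal.
  rewrite deg_leN; apply: (@deg_leW _ (#|A| + #|A| + r)).
    by move: #|A| => a; lia.
  by rewrite expr2 !deg_leM.
- rewrite -big_filter; apply: bool_sos_sum => i; rewrite mem_filter => /andP[iA _].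
  (* For i in A the term lies in the ideal of the axioms, since x_i^2 (x_i - 1) = x_i (x_i^2 -
     x_i). *)
  have -> : xA ^+ 2 * ('X_i - 1) * F =
    ((\prod_(j in A :\ i) 'X_j) ^+ 2 * 'X_i * F) * ('X_i ^+ 2 - 'X_i).
    by rewrite /xA (big_setD1 i) //=; ring.
  apply: bool_sos_ideal.
  have dB : (deg (\prod_(j in A :\ i) 'X_j : {mpoly R[n]}) <= #|A :\ i|)%N.
    by rewrite -big_enum cardE; apply: deg_le_prod => j _; exact: deg_leX.
  have cA := cardsD1 i A; rewrite iA in cA.
  apply: (@deg_leW _ (#|A :\ i| + #|A :\ i| + 1 + r)).
    by move: cA; move: #|A| #|A :\ i| => a b /= ->; lia.
  by rewrite expr2 !deg_leM ?deg_leX.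
Qed.

Lemma bool_sos_ffact r : bool_sos r (\prod_(0 <= m < r) (S - m%:R)).
Proof.
have := bool_sos_mon_ffact set0 r.
by rewrite cards0 big_set0 expr1n mul1r add0n /index_iota subn0.
Qed.

Lemma deg_le_horner_alg (p : {poly R}) d :
  (size p <= d.+1)%N -> (deg (horner_alg S p) <= d)%N.
Proof.
elim/poly_ind: p d => [|p c IH] d sp; first by rewrite rmorph0 /deg mmeasure0.
rewrite rmorphD rmorphM /= horner_algX horner_algC.
have dc : (deg (c%:A : {mpoly R[n]}) <= d)%N by apply: deg_leZ; apply: deg_le1.
apply: deg_leD => //.
have [->|p0] := eqVneq p 0; first by rewrite rmorph0 mul0r /deg mmeasure0.
case: d sp dc => [|d] sp _; move: sp; rewrite size_MXaddC (negPf p0) /=.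
  by rewrite ltnS leqn0 size_poly_eq0 (negPf p0).
by rewrite ltnS => sp; rewrite -addn1; apply: deg_leM (deg_le_sumX); apply: IH.
Qed.

End BooleanSoS.

Arguments bool_sos {R n} D f.

(** * Polynomials nonnegative on an interval (Lukács' theorem) *)

Section IntervalCone.
Variable R : realType.
Implicit Types (p q w : {poly R}) (a b c : R).

(** The truncated preordering of [a, b]: sums of terms w^2 (t - a)^e (b - t)^d with e, d in {0, 1}.
    As [size w] is deg w + 1 for nonzero w, the bound [N.+2] says that each term has degree at most
    N. *)
Inductive itv_cone a b : nat -> {poly R} -> Prop :=
| ItvConeTerm N w (e d : bool) : (2 * size w + e + d <= N.+2)%N ->
    itv_cone a b N (w ^+ 2 * ('X - a%:P) ^+ e * (b%:P - 'X) ^+ d)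
| ItvConeAdd N p q : itv_cone a b N p -> itv_cone a b N q -> itv_cone a b N (p + q).

Lemma size_mul_XsubC_le w c : (size (w * ('X - c%:P))%R <= (size w).+1)%N.
Proof. by apply: leq_trans (size_polyMleq _ _) _; rewrite size_XsubC addn2. Qed.

Lemma itv_coneM2 a b N p c :
  itv_cone a b N p -> itv_cone a b N.+2 (p * ('X - c%:P) ^+ 2).
Proof.
elim=> {N p} [N w e d hw|N p q _ IHp _ IHq]; last first.
  by rewrite mulrDl; apply: ItvConeAdd.
have -> : w ^+ 2 * ('X - a%:P) ^+ e * (b%:P - 'X) ^+ d * ('X - c%:P) ^+ 2 =
  (w * ('X - c%:P)) ^+ 2 * ('X - a%:P) ^+ e * (b%:P - 'X) ^+ d by ring.
by apply: ItvConeTerm; have := size_mul_XsubC_le w c; lia.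
Qed.

(** If the term already carries a factor t - a, the two copies merge into the square w^2, so the
    exponent stays boolean. *)
Lemma itv_coneMl a b N p :
  itv_cone a b N p -> itv_cone a b N.+1 (p * ('X - a%:P)).
Proof.
elim=> {N p} [N w e d hw|N p q _ IHp _ IHq]; last first.
  by rewrite mulrDl; apply: ItvConeAdd.
case: e hw => hw.
  have -> : w ^+ 2 * ('X - a%:P) ^+ true * (b%:P - 'X) ^+ d * ('X - a%:P) =
    (w * ('X - a%:P)) ^+ 2 * ('X - a%:P) ^+ false * (b%:P - 'X) ^+ d.
    by rewrite expr1 expr0; ring.
  by apply: ItvConeTerm; have := size_mul_XsubC_le w a; lia.
have -> : w ^+ 2 * ('X - a%:P) ^+ false * (b%:P - 'X) ^+ d * ('X - a%:P) =
  w ^+ 2 * ('X - a%:P) ^+ true * (b%:P - 'X) ^+ d.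
  by rewrite expr1 expr0; ring.
by apply: ItvConeTerm; lia.
Qed.

Lemma itv_coneMr a b N p :
  itv_cone a b N p -> itv_cone a b N.+1 (p * (b%:P - 'X)).
Proof.
elim=> {N p} [N w e d hw|N p q _ IHp _ IHq]; last first.
  by rewrite mulrDl; apply: ItvConeAdd.
case: d hw => hw.
  have -> : w ^+ 2 * ('X - a%:P) ^+ e * (b%:P - 'X) ^+ true * (b%:P - 'X) =
    (w * ('X - b%:P)) ^+ 2 * ('X - a%:P) ^+ e * (b%:P - 'X) ^+ false.
    by rewrite expr1 expr0; ring.
  by apply: ItvConeTerm; have := size_mul_XsubC_le w b; lia.
have -> : w ^+ 2 * ('X - a%:P) ^+ e * (b%:P - 'X) ^+ false * (b%:P - 'X) =
  w ^+ 2 * ('X - a%:P) ^+ e * (b%:P - 'X) ^+ true.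
  by rewrite expr1 expr0; ring.
by apply: ItvConeTerm; lia.
Qed.

Lemma itv_coneC a b N c : 0 <= c -> itv_cone a b N c%:P.
Proof.
move=> c0.
have -> : c%:P = (Num.sqrt c)%:P ^+ 2 * ('X - a%:P) ^+ false * (b%:P - 'X) ^+ false.
  by rewrite !expr0 !mulr1 -polyC_exp sqr_sqrtr.
apply: ItvConeTerm; rewrite !addn0.
by apply: (@leq_trans (2 * 1)); rewrite // leq_mul2l size_polyC_leq1.
Qed.

(** By continuity. This gives the sign of a quotient by t - c at c itself, where the sign of the
    product carries no information. *)
Lemma horner_ge0_right p a b :
  a < b -> (forall t, a < t < b -> 0 <= p.[t]) -> 0 <= p.[a].
Proof.
move=> ab h; rewrite leNgt; apply/negP => pa.
have [d d0 hd] := @poly_cont R a p (- p.[a]) ltac:(by rewrite oppr_gt0).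
have [/= m0 m1 m2] : [/\ 0 < Num.min d (b - a), Num.min d (b - a) <= d
   & Num.min d (b - a) <= b - a].
  by rewrite lt_min d0 subr_gt0 ab !ge_min !lexx orbT.
set m := Num.min _ _ in m0 m1 m2.
have := hd (a + m / 2) ltac:(rewrite addrC addKr ger0_norm; lra).
have := h (a + m / 2) ltac:(apply/andP; split; lra).
move: (p.[a + m / 2]) pa => x pa x0; rewrite ger0_norm; lra.
Qed.

Lemma horner_ge0_left p a b :
  a < b -> (forall t, a < t < b -> 0 <= p.[t]) -> 0 <= p.[b].
Proof.
move=> ab h.
have := @horner_ge0_right (p \Po (- 'X)) (- b) (- a); rewrite ltrN2 => /(_ ab).
rewrite horner_comp !hornerE opprK; apply => t /andP[ht1 ht2].
by rewrite horner_comp !hornerE; apply: h; apply/andP; split; lra.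
Qed.

Lemma horner_min p a b : a <= b ->
  exists2 c, a <= c <= b & forall t, a <= t <= b -> p.[c] <= p.[t].
Proof.
move=> ab.
have [|c] := @derive.EVT_min R (horner p) a b ab.
  apply: subspace_topology.continuous_subspaceT => x.
  exact: derive.continuous_horner.
by rewrite in_itv /= => hc h; exists c => // t ht; apply: h; rewrite in_itv.
Qed.

(* Lukács' theorem: subtract the minimum over [a, b] and divide by the factor
   vanishing at the minimiser, which is a square unless it is an end point. *)
Lemma itv_cone_ge0 N p a b : a < b -> (size p <= N.+1)%N ->
  (forall t, a <= t <= b -> 0 <= p.[t]) -> itv_cone a b N p.
Proof.
move=> ab; elim/ltn_ind: N p => N IH p sp p0.
have [c /andP[ac cb] cmin] := @horner_min p a b (ltW ab).
have m0 : 0 <= p.[c] by apply: p0; rewrite ac.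
have /factor_theorem[p1 p1E] : root (p - p.[c]%:P) c.
  by rewrite rootE !hornerE subrr.
have pE : p = p1 * ('X - c%:P) + p.[c]%:P by rewrite -p1E subrK.
rewrite pE; apply: ItvConeAdd; last exact: itv_coneC.
have h1 t : a <= t <= b -> 0 <= p1.[t] * (t - c).
  move=> ht; have := cmin _ ht; rewrite {2}pE !hornerE; lra.
have sp1 : (size p1 <= N)%N.
  have [->|p10] := eqVneq p1 0; first by rewrite size_poly0.
  have : (size (p1 * ('X - c%:P))%R <= N.+1)%N.
    rewrite -p1E; apply: leq_trans (size_polyD _ _) _; rewrite size_polyN geq_max sp.
    by apply: leq_trans (size_polyC_leq1 _) _.
  by rewrite size_Mmonic ?monicXsubC // size_XsubC addn2.
have zero_cone q : (size q <= 0)%N -> itv_cone a b N q.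
  by rewrite leqn0 size_poly_eq0 => /eqP ->; rewrite -polyC0; apply: itv_coneC.
case: N IH sp sp1 zero_cone => [|N] IH sp sp1 zero_cone.
  apply: zero_cone; move: sp1; rewrite leqn0 size_poly_eq0 => /eqP ->.
  by rewrite mul0r size_poly0.
have pos_r t : c < t <= b -> 0 <= p1.[t].
  move=> /andP[ct tb]; have := h1 t; rewrite tb (le_trans ac (ltW ct)) => /(_ isT).
  by rewrite pmulr_lge0 // subr_gt0.
have pos_l t : a <= t < c -> p1.[t] <= 0.
  move=> /andP[at_ tc]; have := h1 t; rewrite at_ (le_trans (ltW tc) cb) => /(_ isT).
  by rewrite nmulr_lge0 // subr_lt0.
have [ca|ca] := eqVneq a c.
  rewrite -ca; apply: itv_coneMl; apply: IH => // t /andP[at_ tb].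
  have [ta|ta] := eqVneq t a; last first.
    by apply: pos_r; rewrite tb andbT -ca lt_neqAle eq_sym ta.
  rewrite ta; apply: (@horner_ge0_right _ a b) => // s /andP[as_ sb].
  by apply: pos_r; rewrite -ca as_ ltW.
have [bc|bc] := eqVneq b c.
  have -> : p1 * ('X - c%:P) = (- p1) * (b%:P - 'X) by rewrite -bc; ring.
  apply: itv_coneMr; apply: IH => //; first by rewrite size_polyN.
  have neg t : a <= t < b -> 0 <= (- p1).[t].
    by move=> ht; rewrite hornerN oppr_ge0 pos_l // -bc.
  move=> t /andP[at_ tb].
  have [tbE|tbE] := eqVneq t b; last by apply: neg; rewrite at_ lt_neqAle tbE.
  rewrite tbE; apply: (@horner_ge0_left _ a b) => // s /andP[as_ sb].
  by apply: neg; rewrite sb ltW.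
have {ca}ac : a < c by rewrite lt_neqAle ca.
have {bc}cb : c < b by rewrite lt_neqAle eq_sym bc.
(* At an interior minimiser p1 is nonpositive on the left of c and nonnegative on the right, so it
   vanishes at c, and c is a double root of p - p(c). *)
have /factor_theorem[p2 p2E] : root p1 c.
  rewrite rootE; apply/eqP/le_anti; apply/andP; split.
    rewrite -oppr_ge0 -hornerN; apply: (@horner_ge0_left _ a c) => // s /andP[as_ sc].
    by rewrite hornerN oppr_ge0 pos_l // sc ltW.
  apply: (@horner_ge0_right _ c b) => // s /andP[cs sb].
  by rewrite pos_r // cs ltW.
have -> : p1 * ('X - c%:P) = p2 * ('X - c%:P) ^+ 2 by rewrite p2E; ring.
have sp2 : (size p2 <= N)%N.
  have [->|p20] := eqVneq p2 0; first by rewrite size_poly0.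
  by move: sp1; rewrite p2E size_Mmonic ?monicXsubC // size_XsubC addn2.
case: N IH sp sp1 zero_cone sp2 => [|N] IH sp sp1 zero_cone sp2.
  by apply: zero_cone; move: sp2; rewrite !leqn0 !size_poly_eq0 => /eqP ->; rewrite mul0r.
have pos_r2 t : c < t <= b -> 0 <= p2.[t].
  move=> /[dup] /andP[ct _] /pos_r; rewrite p2E !hornerE.
  by rewrite pmulr_lge0 // subr_gt0.
have pos_l2 t : a <= t < c -> 0 <= p2.[t].
  move=> /[dup] /andP[_ ct] /pos_l; rewrite p2E !hornerE.
  by rewrite nmulr_lle0 // subr_lt0.
apply: itv_coneM2; apply: IH => // t /andP[at_ tb].
case: (ltgtP t c) => [tc|ct|->].
- by apply: pos_l2; rewrite at_.
- by apply: pos_r2; rewrite ct.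
apply: (@horner_ge0_right _ c b) => // s /andP[cs sb].
by apply: pos_r2; rewrite cs ltW.
Qed.

End IntervalCone.

Arguments itv_cone {R} a b _ _.

(** * Damping by Chebyshev polynomials *)

Section Damping.
Variable R : realType.
Implicit Types (a b m t x y : R) (c : {poly R}).

(* The pair (T_n, U_(n-1)) of Chebyshev polynomials. *)
Fixpoint cheb n : {poly R} * {poly R} :=
  if n is n'.+1 then
    ('X * (cheb n').1 + ('X ^+ 2 - 1) * (cheb n').2, 'X * (cheb n').2 + (cheb n').1)
  else (1, 0).

Lemma size_cheb n : (size (cheb n).1 <= n.+1)%N /\ (size (cheb n).2 <= n)%N.
Proof.
elim: n => [|n [IH1 IH2]] /=; first by rewrite size_poly1 size_poly0.
have s1 : (size ('X ^+ 2 - 1 : {poly R})%R <= 3)%N.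
  apply: leq_trans (size_polyD _ _) _.
  by rewrite size_polyN size_poly1 size_polyXn.
split; apply: leq_trans (size_polyD _ _) _; rewrite geq_max; apply/andP; split.
- by apply: leq_trans (size_polyMleq _ _) _; rewrite size_polyX.
- apply: leq_trans (size_polyMleq _ _) _.
  by rewrite -subn1 leq_subLR; apply: leq_trans (leq_add s1 IH2) _.
- by apply: leq_trans (size_polyMleq _ _) _; rewrite size_polyX.
- exact: IH1.
Qed.

Lemma cheb_pell n x : (cheb n).1.[x] ^+ 2 - (x ^+ 2 - 1) * (cheb n).2.[x] ^+ 2 = 1.
Proof.
elim: n => [|n IH] /=; first by rewrite !hornerE /=; ring.
by rewrite -[RHS]IH !hornerE /=; ring.
Qed.

(** For |x| <= 1 the second term of the Pell identity, (1 - x^2) U^2, is nonnegative, which leaves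
    T^2 <= 1. *)
Lemma cheb_le1 n x : `|x| <= 1 -> `|(cheb n).1.[x]| <= 1.
Proof.
move=> x1; have := cheb_pell n x.
have : x ^+ 2 <= 1 by move: x1; rewrite ler_norml => /andP[]; nra.
move: ((cheb n).1.[x]) ((cheb n).2.[x]) => u v hx huv.
have : 0 <= (1 - x ^+ 2) * v ^+ 2 by rewrite mulr_ge0 ?sqr_ge0 ?subr_ge0.
by move=> hv; rewrite ler_norml; apply/andP; split; nra.
Qed.

(** The first bound is the tangent line of T_n at 1, of slope n^2; this quadratic slope is what
    makes a degree of order sqrt (n / l) suffice. The two bounds are proved together because the
    recursion mixes T and U. *)
Lemma cheb_ge n x : 1 <= x ->
  1 + n%:R ^+ 2 * (x - 1) <= (cheb n).1.[x] /\ n%:R <= (cheb n).2.[x].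
Proof.
move=> x1; elim: n => [|n [IH1 IH2]] /=; first by rewrite !hornerE; split; lra.
rewrite !hornerE -natr1.
move: ((cheb n).1.[x]) ((cheb n).2.[x]) (ler0n R n) IH1 IH2 => u v.
move: (n%:R) => N N0 IH1 IH2.
have [y y0 xE] : exists2 y, 0 <= y & x = 1 + y by exists (x - 1); lra.
subst x; rewrite [1 + y]addrC addrK in IH1.
have y2 : 0 <= N ^+ 2 * y by rewrite mulr_ge0 // sqr_ge0.
split; last by nra.
have h1 : 0 <= y * (u - (1 + N ^+ 2 * y)) by rewrite mulr_ge0 // subr_ge0.
have h2 : 0 <= (2 * y + y ^+ 2) * (v - N).
  by rewrite mulr_ge0 ?subr_ge0 //; nra.
have h3 : 0 <= y * (N ^+ 2 * y) by rewrite mulr_ge0.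
have h4 : 0 <= N * (y * y) by rewrite !mulr_ge0.
nra.
Qed.

(** The coefficients x and x^2 - 1 of the recursion are nonnegative and increasing on [1, oo), as
    are T and U by induction. *)
Lemma cheb_mono n x y : 1 <= x -> x <= y ->
  (cheb n).1.[x] <= (cheb n).1.[y] /\ (cheb n).2.[x] <= (cheb n).2.[y].
Proof.
move=> x1 xy; elim: n => [|n [IH1 IH2]] /=; first by rewrite !hornerE.
have [Tx Ux] := cheb_ge n x x1.
have Tx0 : 0 <= (cheb n).1.[x].
  by apply: le_trans Tx; rewrite addr_ge0 // mulr_ge0 ?sqr_ge0 // subr_ge0.
have Ux0 : 0 <= (cheb n).2.[x] by apply: le_trans Ux.
have x2 : 0 <= x ^+ 2 - 1 by rewrite subr_ge0 exprn_ege1.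
have x0 : 0 <= x by lra.
have xy2 : x ^+ 2 - 1 <= y ^+ 2 - 1 by nra.
rewrite !hornerE; split; apply: lerD => //; exact: ler_pM.
Qed.

(** Take T_D(y(t)) / T_D(y(a)), where the decreasing affine map y sends m to 1 and b to -1. Then
    y(a) lies beyond 1, and the hypothesis on D makes T_D(y(a)) at least 2, whereas |T_D(y)| <= 1 on
    [m, b]; between a and m, T_D(y) is at most its value at a by monotonicity. *)
Lemma damping_poly a m b D : a < m -> m < b -> b - m <= D%:R ^+ 2 * (m - a) ->
  exists c, [/\ (size c <= D.+1)%N, c.[a] = 1,
    forall t, a <= t <= b -> `|c.[t]| <= 1 &
    forall t, m <= t <= b -> `|c.[t]| <= 2^-1].
Proof.
move=> am mb hD.
pose s : R := 2 / (b - m).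
have bm0 : 0 < b - m by rewrite subr_gt0.
have s0 : 0 < s by rewrite divr_gt0.
have sbm : s * (b - m) = 2 by rewrite /s mulfVK // gt_eqF.
pose y (t : R) := 1 + s * (m - t).
pose yp : {poly R} := (1 + s * m)%:P - s *: 'X.
have ypE t : yp.[t] = y t by rewrite /yp /y !hornerE; ring.
have ya : 1 <= y a by rewrite /y lerDl mulr_ge0 ?subr_ge0 // ltW.
set T := (cheb D).1.
have Ta : 2 <= T.[y a].
  have [+ _] := cheb_ge D (y a) ya; apply: le_trans.
  rewrite /y [1 + s * _]addrC addrK.
  have : s * (b - m) <= s * (D%:R ^+ 2 * (m - a)) by rewrite ler_pM2l.
  rewrite sbm; move: (D%:R ^+ 2) (m - a) => u v; lra.
have Ta0 : 0 < T.[y a] by lra.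
have iTa : T.[y a]^-1 <= 2^-1 by rewrite lef_pV2 ?posrE.
have iTa0 : 0 <= T.[y a]^-1 by rewrite invr_ge0 ltW.
have cE t : (T.[y a]^-1 *: (T \Po yp)).[t] = T.[y a]^-1 * T.[y t].
  by rewrite hornerZ horner_comp ypE.
have near_b t : m <= t <= b -> `|T.[y t]| <= 1.
  move=> /andP[mt tb]; apply: cheb_le1; rewrite ler_norml /y.
  have : s * (t - m) <= s * (b - m) by rewrite ler_pM2l // lerD2r.
  have : 0 <= s * (t - m) by rewrite mulr_ge0 ?subr_ge0 // ltW.
  rewrite sbm => h1 h2; apply/andP; split; lra.
exists (T.[y a]^-1 *: (T \Po yp)); split.
- apply: leq_trans (size_scale_leq _ _) _.
  have syp : (size yp <= 2)%N.
    apply: leq_trans (size_polyD _ _) _; rewrite size_polyN geq_max.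
    rewrite (leq_trans (size_polyC_leq1 _)) //=.
    by apply: leq_trans (size_scale_leq _ _) _; rewrite size_polyX.
  have [sT _] := size_cheb D.
  apply: leq_trans (size_comp_poly_leq _ _) _; rewrite ltnS.
  apply: (@leq_trans (D * 1)); last by rewrite muln1.
  apply: leq_mul; first by rewrite -subn1 leq_subLR add1n.
  by rewrite -subn1 leq_subLR.
- by rewrite cE mulVf // gt_eqF.
- move=> t /andP[at_ tb]; rewrite cE normrM (ger0_norm iTa0).
  rewrite mulrC ler_pdivrMr // mul1r.
  have [mt|tm] := leP m t.
    by apply: le_trans (near_b t _) _; [rewrite mt|lra].
  have yt : 1 <= y t by rewrite /y lerDl mulr_ge0 ?subr_ge0 // ltW.
  have yta : y t <= y a by rewrite /y lerD2l ler_pM2l // lerD2l lerN2.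
  have [h _] := cheb_mono D (y t) (y a) yt yta.
  have [h2 _] := cheb_ge D (y t) yt.
  rewrite ger0_norm //; apply: le_trans h2.
  by rewrite addr_ge0 // mulr_ge0 ?sqr_ge0 // subr_ge0.
- move=> t /near_b h; rewrite cE normrM (ger0_norm iTa0).
  by rewrite -[2^-1]mulr1; apply: ler_pM.
Qed.

(* Multiplying dampers that take effect at distance 1, ..., k from [j]: the
   l-th one costs degree about sqrt (n / l), whence sqrt (n * k) in total. *)
Lemma damping_prod (n j k P : nat) (D : nat -> nat) : (j + k < n)%N ->
  (forall l, (0 < l <= k)%N -> n%:R <= (D l)%:R ^+ 2 * l%:R :> R) ->
  exists c, [/\ (size c <= (P * \sum_(1 <= l < k.+1) D l).+1)%N, c.[j%:R] = 1 &
    forall (M : nat) t, (M <= k)%N -> (j + M)%:R <= t <= n%:R ->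
      `|c.[t]| <= 2^-1 ^+ (P * M)].
Proof.
elim: k => [|k IH] jkn hD.
  exists 1; split; rewrite ?size_poly1 ?hornerC // => M t.
  by rewrite leqn0 => /eqP -> _; rewrite muln0 hornerC normr1.
have [|l /andP[l0 lk]|c [sc cj hc]] := IH; first by lia.
  by apply: hD; rewrite l0 leqW.
have [|||b [sb bj hb1 hb2]] := @damping_poly j%:R (j + k.+1)%:R n%:R (D k.+1).
- by rewrite ltr_nat; lia.
- by rewrite ltr_nat.
- have -> : (j + k.+1)%:R - j%:R = k.+1%:R :> R by rewrite natrD addrC addKr.
  by apply: le_trans (hD k.+1 _); rewrite ?leqnn // gerBl.
exists (c * b ^+ P); split.
- have [->|c0] := eqVneq c 0; first by rewrite mul0r size_poly0.
  have sbP : (size (b ^+ P)%R <= (D k.+1 * P).+1)%N.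
    apply: leq_trans (size_poly_exp_leq _ _) _; rewrite ltnS leq_mul2r.
    by apply/orP; right; rewrite -subn1 leq_subLR add1n.
  apply: leq_trans (size_polyMleq _ _) _.
  rewrite big_nat_recr //= mulnDr -subn1 leq_subLR.
  by apply: leq_trans (leq_add sc sbP) _; rewrite [(P * D _)%N]mulnC; lia.
- by rewrite hornerM horner_exp cj bj expr1n mulr1.
- move=> M t Mk /andP[jMt tn].
  have jt : (j%:R : R) <= t by apply: le_trans jMt; rewrite ler_nat leq_addr.
  rewrite hornerM horner_exp normrM normrX.
  (* For M <= k the new factor is at most 1 in absolute value. For M = k + 1 it contributes the
     missing 2^-P, and the induction hypothesis is used at distance k. *)
  move: Mk; rewrite leq_eqVlt => /orP[/eqP ME|]; last first.
    rewrite ltnS => Mk; rewrite -[leRHS]mulr1; apply: ler_pM; rewrite ?exprn_ge0 //.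
      by apply: hc; rewrite // jMt.
    by apply: exprn_ile1 => //; apply: hb1; rewrite jt.
  rewrite ME in jMt *; rewrite mulnS exprD [leRHS]mulrC.
  apply: ler_pM; rewrite ?exprn_ge0 //.
    apply: (hc k) => //; rewrite tn andbT; apply: le_trans jMt.
    by rewrite ler_nat leq_add2l.
  by apply: lerXn2r; rewrite ?nnegrE ?invr_ge0 ?ler0n //; apply: hb2; rewrite jMt.
Qed.

End Damping.

(** * Bounds on Lagrange polynomials and their damping *)

Section Interpolation.
Variable R : realType.

Lemma bernoulli_le (x : R) h : 0 <= x -> 1 + h%:R * x <= (1 + x) ^+ h.
Proof.
move=> x0; elim: h => [|h IH]; first by rewrite mul0r addr0 expr0.
rewrite exprS -natr1.
have : (1 + x) * (1 + h%:R * x) <= (1 + x) * (1 + x) ^+ h.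
  by rewrite ler_wpM2l // addr_ge0.
apply: le_trans.
have : 0 <= h%:R * (x * x) by rewrite !mulr_ge0.
lra.
Qed.

(** For t - j <= h this bounds the Lagrange factor |(t - i) / (j - i)| of a node i at distance a
    from j. *)
Let g (h a : nat) : R := 1 + h%:R / a%:R.

Let g_ge1 h a : 1 <= g h a.
Proof. by rewrite lerDl divr_ge0. Qed.

(** The product is the binomial coefficient C(h + m, m). This bound serves when h is small, that is
    for t close to j; [prod_ratio_le_exp] serves when t is far from j. The induction step is
    Bernoulli's inequality for ((m + 2) / (m + 1))^h. *)
Lemma prod_ratio_le_expn h m : \prod_(1 <= a < m.+1) g h a <= m.+1%:R ^+ h.
Proof.
elim: m => [|m IH]; first by rewrite big_geq // expr1n.
rewrite big_nat_recr //=.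
have m0 : m.+1%:R != 0 :> R by rewrite pnatr_eq0.
have -> : m.+2%:R = m.+1%:R * (1 + m.+1%:R^-1) :> R.
  by rewrite mulrDr mulr1 mulfV // natr1.
rewrite exprMn; apply: ler_pM => //.
- by apply: prodr_ge0 => a _; apply: le_trans (g_ge1 _ _).
- by apply: le_trans (g_ge1 _ _).
- by apply: bernoulli_le; rewrite invr_ge0.
Qed.

Lemma prod_ratio_le_exp h m : \prod_(1 <= a < m.+1) g h a <= h.+1%:R ^+ m.
Proof.
elim: m => [|m IH]; first by rewrite big_geq.
rewrite big_nat_recr //= exprSr; apply: ler_pM => //.
- by apply: prodr_ge0 => a _; apply: le_trans (g_ge1 _ _).
- by apply: le_trans (g_ge1 _ _).
- by rewrite /g -[h.+1%:R]natr1 addrC lerD2r ler_pdivrMr // ler_peMr // ler1n.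
Qed.

(** M is the integer part of t - j, capped at k, the largest distance at which a damper acts. The
    nodes below j and those above j each contribute a product of factors [g], at most n^(2 M). *)
Lemma lagrange_bound (n k j : nat) (t : R) :
  (2 <= k)%N -> (k.+1 <= n)%N -> (j.+2 <= k)%N -> k.+1%:R <= t <= n%:R ->
  exists M : nat, [/\ (2 <= M <= k)%N, (j + M)%:R <= t &
    `|\prod_(i <- iota 0 j ++ iota j.+1 (k - j)) ((t - i%:R) / (j%:R - i%:R))|
    <= n%:R ^+ (4 * M)].
Proof.
move=> k2 kn jk /andP[kt tn].
pose f := Num.truncn (t - j%:R); pose h := f.+1.
have tj0 : 0 <= t - j%:R.
  by rewrite subr_ge0; apply: le_trans kt; rewrite ler_nat; lia.
have /andP[ft tf] := truncn_itv tj0; rewrite -/f in ft tf.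
have f3 : (3 <= f)%N.
  rewrite /f truncn_ge_nat // lerBrDr -natrD; apply: le_trans kt.
  by rewrite ler_nat; lia.
have fn : (f <= n)%N.
  rewrite -(ler_nat R); apply: le_trans ft _.
  by rewrite lerBlDr; apply: le_trans tn _; rewrite lerDl.
exists (minn f k); split; first by lia.
  rewrite natrD addrC -lerBrDr; apply: le_trans ft.
  by rewrite ler_nat geq_minl.
(* If f <= k, the bound (m + 1)^h has base at most n and exponent f + 1 <= 2 f. Otherwise (h + 1)^m
   has base f + 2 <= n^2 and exponent at most k. *)
have gb m : (m <= k)%N -> \prod_(1 <= a < m.+1) g h a <= n%:R ^+ (2 * minn f k).
  move=> mk.
  have [fk|kf] := leqP f k.
    apply: le_trans (prod_ratio_le_expn _ _) _.
    apply: (@le_trans _ _ (n%:R ^+ h)).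
      by apply: lerXn2r; rewrite ?nnegrE ?ler0n // ler_nat; lia.
    by apply: ler_weXn2l; [rewrite ler1n|rewrite /h]; lia.
  apply: le_trans (prod_ratio_le_exp _ _) _.
  apply: (@le_trans _ _ ((n%:R ^+ 2) ^+ m)).
    apply: lerXn2r; rewrite ?nnegrE ?ler0n ?exprn_ge0 ?ler0n //.
    by rewrite -natrX ler_nat /h; nia.
  by rewrite -exprM; apply: ler_weXn2l; [rewrite ler1n|]; lia.
have fac i : i != j -> `|(t - i%:R) / (j%:R - i%:R)| <= g h (`|j - i|)%N.
  move=> ij.
  have dE : `|j%:R - i%:R| = (`|j - i|)%N%:R :> R.
    have [le_ij|/ltnW le_ji] := leqP i j.
      by rewrite distnEl // natrB // ger0_norm // subr_ge0 ler_nat.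
    by rewrite distnEr // natrB // distrC ger0_norm // subr_ge0 ler_nat.
  have d0 : 0 < (`|j - i|)%N%:R :> R.
    by rewrite -dE normr_gt0 subr_eq0 eqr_nat eq_sym.
  rewrite normrM normfV dE /g ler_pdivrMr // mulrDl mul1r divfK ?gt_eqF //.
  have -> : t - i%:R = (j%:R - i%:R) + (t - j%:R) by ring.
  apply: le_trans (ler_normD _ _) _; rewrite dE lerD2l ger0_norm //.
  exact: ltW.
rewrite normr_prod big_cat /=.
have -> : (4 * minn f k = 2 * minn f k + 2 * minn f k)%N by lia.
rewrite exprD; apply: ler_pM; try by apply: prodr_ge0.
- apply: le_trans (gb j _); last by lia.
  apply: (@le_trans _ _ (\prod_(0 <= i < j) g h (j - i))).
    rewrite /index_iota subn0 big_seq [leRHS]big_seq.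
    apply: ler_prod => i; rewrite mem_iota add0n => /andP[_ ij].
    rewrite normr_ge0 /=; apply: le_trans (fac i _) _; first by rewrite ltn_eqF.
    by rewrite distnEl // ltnW.
  rewrite big_nat_rev big_add1 /= le_eqVlt; apply/orP; left; apply/eqP.
  rewrite big_nat [RHS]big_nat; apply: eq_bigr => i /andP[_ ij].
  by congr g; lia.
- apply: le_trans (gb (k - j)%N _); last by lia.
  rewrite big_seq; apply: (@le_trans _ _ (\prod_(j.+1 <= i < k.+1) g h (i - j))).
    rewrite /index_iota subSS [leRHS]big_seq.
    apply: ler_prod => i; rewrite mem_iota => /andP[ji _].
    rewrite normr_ge0 /=; apply: le_trans (fac i _) _; first by rewrite gtn_eqF.
    by rewrite distnEr // ltnW.
  rewrite -[j.+1]add1n big_addn /= le_eqVlt; apply/orP; left; apply/eqP.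
  rewrite subSn; last by lia.
  by apply: eq_bigr => i _; rewrite addnK.
Qed.

Lemma damped_lagrange (n k j : nat) (D : nat -> nat) (P : nat) :
  (2 <= k)%N -> (k.+1 <= n)%N -> (k <= uphalf n)%N -> (j.+2 <= k)%N ->
  (forall l, (0 < l <= k)%N -> n%:R <= (D l)%:R ^+ 2 * l%:R :> R) ->
  (n ^ 5 <= 2 ^ P)%N ->
  exists u : {poly R},
    [/\ (size u <= (k + P * \sum_(1 <= l < k.+1) D l).+1)%N,
        u.[j%:R] = 1,
        forall i : nat, (i <= k)%N -> i != j -> u.[i%:R] = 0 &
        forall t, k.+1%:R <= t <= n%:R -> `|u.[t]| <= n%:R ^- 2].
Proof.
move=> k2 kn kn2 jk hD hP.
(* All k dampers take effect inside [j, n], because j + k <= 2 k - 2 < n; this is where k <= ceil(n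
   / 2) enters. *)
have [|c [sc cj hc]] := @damping_prod R n j k P D _ hD; first by lia.
set r := iota 0 j ++ iota j.+1 (k - j).
have jr i : i \in r -> i != j.
  by rewrite mem_cat !mem_iota => /orP[] h; lia.
pose L : {poly R} := \prod_(i <- r) ((j%:R - i%:R)^-1 *: ('X - i%:R%:P)).
have LE t : L.[t] = \prod_(i <- r) ((t - i%:R) / (j%:R - i%:R)).
  by rewrite horner_prod; apply: eq_bigr => i _; rewrite !hornerE mulrC.
exists (L * c); split.
- have sL : (size L <= k.+1)%N.
    have -> : k.+1 = (size r).+1 by rewrite size_cat !size_iota; lia.
    rewrite /L; elim: (r) => [|i s IH]; first by rewrite big_nil size_poly1.
    rewrite big_cons; apply: leq_trans (size_polyMleq _ _) _.
    rewrite -subn1 leq_subLR add1n /= -[(size s).+3]/(2 + (size s).+1)%N leq_add //.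
    by apply: leq_trans (size_scale_leq _ _) _; rewrite size_XsubC.
  apply: leq_trans (size_polyMleq _ _) _.
  rewrite -subn1 leq_subLR; apply: leq_trans (leq_add sL sc) _; lia.
- rewrite hornerM cj mulr1 LE big_seq big1 // => i /jr ij.
  by rewrite divff // subr_eq0 eqr_nat eq_sym.
- move=> i ik ij; rewrite hornerM LE.
  have ir : i \in r by rewrite mem_cat !mem_iota; lia.
  by rewrite (big_rem i ir) /= subrr !mul0r.
- move=> t ht.
  have [M [/andP[M2 Mk] jMt hL]] := @lagrange_bound n k j t k2 kn jk ht.
  have {}hc := hc M t Mk; rewrite jMt in hc.
  have /andP[_ tn] := ht.
  have n0 : 0 < n%:R :> R by rewrite ltr0n; lia.
  rewrite hornerM LE normrM.
  (* The damping 2^-(P M) is at most n^-(5 M), which beats the Lagrange bound n^(4 M) by n^-M; and M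
     >= 2. *)
  apply: (@le_trans _ _ (n%:R ^+ (4 * M) * n%:R ^- (5 * M))).
    apply: ler_pM => //; apply: le_trans (hc tn) _.
    rewrite exprVn lef_pV2 ?posrE ?exprn_gt0 // -!natrX ler_nat !expnM.
    by rewrite leq_exp2r //; lia.
  have -> : (5 * M = 4 * M + M)%N by lia.
  rewrite exprD invfM mulrA mulfV ?mul1r; last by rewrite expf_neq0 // gt_eqF.
  rewrite lef_pV2 ?posrE ?exprn_gt0 //; apply: ler_weXn2l => //.
  by rewrite ler1n; lia.
Qed.

End Interpolation.

(** * Assembling the certificate *)

Section Certificate.
Variable R : realType.

Let qpoly (k : nat) : {poly R} := ('X - k%:R%:P) * ('X - k%:R%:P + 1).

Let qpolyE k t : (qpoly k).[t] = (t - k%:R) * (t - k%:R + 1).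
Proof. by rewrite /qpoly !hornerE. Qed.

Lemma horner_alg_sos_q n k :
  horner_alg (\sum_(i < n) 'X_i : {mpoly R[n]}) (qpoly k) = sos_q R n k.
Proof.
rewrite /qpoly /sos_q rmorphM !rmorphD !rmorphN rmorph1 /= horner_algX.
by rewrite !rmorph_nat.
Qed.

Lemma qpoly_nat_ge0 k j : (j < k)%N -> 0 <= (qpoly k).[j%:R].
Proof.
move=> jk; rewrite qpolyE mulr_le0 // ?subr_le0 ?ler_nat 1?ltnW //.
by rewrite addrAC natr1 subr_le0 ler_nat.
Qed.

(** The index j stops at k - 2 because q itself vanishes at k - 1 and k, as do all the u_j. *)
Lemma qpoly_decomposition (n k : nat) (D : nat -> nat) (P : nat) :
  (2 <= k)%N -> (k.+1 <= n)%N -> (k <= uphalf n)%N ->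
  (forall l, (0 < l <= k)%N -> n%:R <= (D l)%:R ^+ 2 * l%:R :> R) ->
  (n ^ 5 <= 2 ^ P)%N ->
  let N := (k + P * \sum_(1 <= l < k.+1) D l)%N in
  exists (u : 'I_k.-1 -> {poly R}) (r : {poly R}),
    [/\ forall j, (size (u j) <= N.+1)%N,
        (size r <= (2 * N).+1)%N,
        forall t, k.+1%:R <= t <= n%:R -> 0 <= r.[t] &
        qpoly k = \sum_(j < k.-1) (qpoly k).[j%:R] *: u j ^+ 2
                  + r * \prod_(0 <= i < k.+1) ('X - i%:R%:P)].
Proof.
move=> k2 kn kn2 hD hP N.
have jk (j : 'I_k.-1) : (j.+2 <= k)%N by have := ltn_ord j; lia.
have [u hu] := fin_all_exists (fun j : 'I_k.-1 =>
  @damped_lagrange R n k j D P k2 kn kn2 (jk j) hD hP).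
pose p := qpoly k - \sum_(j < k.-1) (qpoly k).[j%:R] *: u j ^+ 2.
have pE t : p.[t] = (qpoly k).[t] - \sum_(j < k.-1) (qpoly k).[j%:R] * (u j).[t] ^+ 2.
  rewrite hornerD hornerN horner_sum; congr (_ - _); apply: eq_bigr => j _.
  by rewrite hornerZ horner_exp.
have proots : all (root p) [seq i%:R | i <- iota 0 k.+1].
  apply/allP => _ /mapP[i + ->]; rewrite mem_iota add0n => /andP[_ ik].
  rewrite rootE pE subr_eq0; apply/eqP.
  have [ik1|ki] := ltnP i k.-1.
    rewrite (bigD1 (Ordinal ik1)) //= big1 => [|j ji].
      by have [_ -> _ _] := hu (Ordinal ik1); rewrite expr1n mulr1 addr0.
    have [_ _ -> //] := hu j; first by rewrite expr0n mulr0.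
    by move: ji; rewrite -val_eqE /= eq_sym.
  rewrite big1 => [|j _].
    rewrite qpolyE; have [->|ik'] := eqVneq i k; first by rewrite subrr mul0r.
    have -> : k = i.+1 by lia.
    by rewrite -natr1 opprD addrA subrr sub0r addNr mulr0.
  have [_ _ -> //] := hu j; first by rewrite expr0n mulr0.
  by have := ltn_ord j; lia.
have [|r rE] := uniq_roots_prod_XsubC proots.
  by rewrite uniq_rootsE map_inj_uniq ?iota_uniq // => i j /eqP; rewrite eqr_nat => /eqP.
rewrite big_map in rE.
set F := \prod_(0 <= i < k.+1) _.
have {}rE : p = r * F by exact: rE.
exists u, r; split.
- by move=> j; have [] := hu j.
- have [->|r0] := eqVneq r 0; first by rewrite size_poly0.
  have sp : (size p <= (2 * N).+1)%N.
    apply: leq_trans (size_polyD _ _) _; rewrite size_polyN geq_max; apply/andP; split.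
      apply: leq_trans (size_polyMleq _ _) _.
      have -> : 'X - k%:R%:P + 1 = 'X + (1 - k%:R)%:P :> {poly R}.
        by rewrite polyCB polyC1; ring.
      rewrite size_XsubC size_XaddC /N; lia.
    apply: leq_trans (size_sum _ _ _) _; apply/bigmax_leqP => j _.
    have [su _ _ _] := hu j.
    apply: leq_trans (size_scale_leq _ _) _; rewrite expr2.
    apply: leq_trans (size_polyMleq _ _) _.
    by rewrite -subn1 leq_subLR; apply: leq_trans (leq_add su su) _; rewrite /N; lia.
  have Fm : F \is monic by apply: monic_prod => i _; apply: monicXsubC.
  have F0 : (0 < size F)%N by rewrite size_poly_gt0 monic_neq0.
  apply: leq_trans sp; rewrite rE size_Mmonic //.
  by rewrite -subn1 -addnBA // leq_addr.
- move=> t ht; have /andP[kt tn] := ht.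
  have F0 : 0 < F.[t].
    rewrite horner_prod big_seq; apply: prodr_gt0 => i.
    rewrite mem_index_iota => /andP[_ ik]; rewrite hornerXsubC subr_gt0.
    by apply: lt_le_trans kt; rewrite ltr_nat.
  rewrite -(pmulr_lge0 _ F0) -hornerM -rE pE subr_ge0.
  have n0 : 0 < n%:R :> R by rewrite ltr0n; lia.
  (* Each q(j) is at most n^2 and each u_j(t)^2 at most n^-4, so the sum is at most (k - 1) / n^2 <=
     1, while q(t) >= 1 for t >= k + 1. *)
  apply: (@le_trans _ _ (\sum_(j < k.-1) n%:R ^- 2)).
    apply: ler_sum => j _.
    have [_ _ _ /(_ t ht) ut] := hu j.
    have -> : (n%:R ^- 2 : R) = n%:R ^+ 2 * (n%:R ^- 2) ^+ 2.
      by field; rewrite gt_eqF.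
    have jlk := ltn_ord j.
    apply: ler_pM; rewrite ?sqr_ge0 ?qpoly_nat_ge0 //; [by lia| |].
      rewrite qpolyE -mulrNN !opprD !opprK expr2; apply: ler_pM.
      + by rewrite addrC subr_ge0 ler_nat; lia.
      + by rewrite [- _ + _]addrC -addrA -opprD natr1 subr_ge0 ler_nat; lia.
      + by rewrite addrC lerBlDr -natrD ler_nat; lia.
      + by rewrite [- _ + _]addrC -addrA -opprD natr1 lerBlDr -natrD ler_nat; lia.
    rewrite -real_normK ?num_real //.
    by apply: lerXn2r; rewrite ?nnegrE ?invr_ge0 ?exprn_ge0.
  rewrite sumr_const card_ord -[leLHS]mulr_natl qpolyE.
  have t1 : 1 <= t - k%:R by rewrite lerBrDl natr1.
  have s1 : (k.-1)%:R * n%:R ^- 2 <= 1 :> R.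
    rewrite ler_pdivrMr ?exprn_gt0 // mul1r -natrX ler_nat; nia.
  by apply: (le_trans s1); nra.
- by rewrite -rE /p addrC subrK.
Qed.

(** In a term w^2 (t - m)^e (n - t)^d of the cone, the factor t - m extends the falling factorial t
    (t - 1) ... (t - m + 1) by one step, n - t is absorbed by [bool_sosM_compl], and w^2 by
    [bool_sosM2]. *)
Lemma bool_sos_itv_cone n m N (p : {poly R}) :
  itv_cone m%:R n%:R (2 * N) p ->
  bool_sos (N + m + 2) (horner_alg (\sum_(i < n) 'X_i : {mpoly R[n]})
    (p * \prod_(0 <= i < m) ('X - i%:R%:P))).
Proof.
set S : {mpoly R[n]} := \sum_(i < n) _.
have FE r : horner_alg S (\prod_(0 <= i < r) ('X - i%:R%:P)) =
    \prod_(0 <= i < r) (S - i%:R).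
  rewrite rmorph_prod; apply: eq_bigr => i _.
  by rewrite rmorphB /= horner_algX !rmorph_nat.
move: (leqnn (2 * N)); move: {1 3}(2 * N)%N => M + h.
elim: h => {M p} [M w e d hw|M p q _ IHp _ IHq] MN; last first.
  by rewrite mulrDl rmorphD; apply: bool_sosD; [apply: IHp|apply: IHq].
have sw : (size w <= N.+1)%N by lia.
have hF : bool_sos (m + e) (horner_alg S
    (('X - m%:R%:P) ^+ e * \prod_(0 <= i < m) ('X - i%:R%:P))).
  have -> : ('X - (m%:R : R)%:P) ^+ e * \prod_(0 <= i < m) ('X - (i%:R : R)%:P) =
      \prod_(0 <= i < m + e) ('X - (i%:R : R)%:P).
    case: e {hw}; last by rewrite mul1r addn0.
    by rewrite addn1 big_nat_recr //= mulrC.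
  by rewrite FE; apply: bool_sos_ffact.
have {}hF : bool_sos (m + e + d) (horner_alg S
    (('X - m%:R%:P) ^+ e * \prod_(0 <= i < m) ('X - i%:R%:P) * (n%:R%:P - 'X) ^+ d)).
  rewrite rmorphM /=; case: d {hw}; last by rewrite rmorph1 mulr1 addn0.
  have -> : horner_alg S ((n%:R%:P - 'X) ^+ true) = n%:R - S.
    by rewrite rmorphB /= horner_algX !rmorph_nat.
  by rewrite addn1; apply: bool_sosM_compl.
have := bool_sosM2 _ _ _ _ _ _ (deg_le_horner_alg _ n _ _ sw) hF.
rewrite -rmorphXn -rmorphM /=.
have -> : w ^+ 2 * (('X - m%:R%:P) ^+ e * \prod_(0 <= i < m) ('X - i%:R%:P)
    * (n%:R%:P - 'X) ^+ d) = w ^+ 2 * ('X - m%:R%:P) ^+ e * (n%:R%:P - 'X) ^+ d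
    * \prod_(0 <= i < m) ('X - (i%:R : R)%:P) by ring.
by apply: bool_sosW; lia.
Qed.

Lemma bool_sos_sos_q (n k : nat) (D : nat -> nat) (P : nat) :
  (2 <= k)%N -> (k.+1 < n)%N -> (k <= uphalf n)%N ->
  (forall l, (0 < l <= k)%N -> n%:R <= (D l)%:R ^+ 2 * l%:R :> R) ->
  (n ^ 5 <= 2 ^ P)%N ->
  bool_sos (k + P * \sum_(1 <= l < k.+1) D l + k.+1 + 2) (sos_q R n k).
Proof.
move=> k2 kn kn2 hD hP.
have [u [r [su sr r0 qE]]] := qpoly_decomposition n k D P k2 (ltnW kn) kn2 hD hP.
rewrite -horner_alg_sos_q qE rmorphD rmorph_sum /=; apply: bool_sosD; last first.
  by apply: bool_sos_itv_cone; apply: itv_cone_ge0; rewrite // ltr_nat.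
apply: bool_sos_sum => j _; rewrite linearZ /= mulr_algl rmorphXn.
apply: bool_sosZ; first by apply: qpoly_nat_ge0; have := ltn_ord j; lia.
apply: bool_sosX2; apply: leq_trans (deg_le_horner_alg _ _ _ _ (su j)) _.
by rewrite -addnA leq_addr.
Qed.

(* For n = 3 and k = 2 the interval [k + 1, n] degenerates. *)
Lemma bool_sos_sos_q_3_2 : bool_sos 4 (sos_q R 3 2).
Proof.
set S : {mpoly R[3]} := \sum_(i < 3) 'X_i.
(* Here q = (S - 1) (S - 2) and q - 2 = S (S - 3), so 2 q = q^2 - q (q - 2) = q^2 + S (S - 1) (S -
   2) (3 - S). *)
have -> : sos_q R 3 2 = 2^-1 *: (sos_q R 3 2) ^+ 2
    + 2^-1 *: ((\prod_(0 <= i < 3) (S - i%:R)) * (3%:R - S)).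
  rewrite -scalerDr; apply: (@scalerI _ _ 2); first by rewrite pnatr_eq0.
  rewrite scalerA mulfV ?pnatr_eq0 // scale1r scaler_nat.
  by rewrite /sos_q -/S unlock /=; ring.
apply: bool_sosD; apply: bool_sosZ; rewrite ?invr_ge0 ?ler0n //; last first.
  by apply: bool_sosM_compl; apply: bool_sos_ffact.
apply: bool_sosX2; apply: (deg_leW _ _ _ (1 + 1)) => //.
have dS : (deg (S - 2%:R) <= 1)%N.
  by apply: deg_leB; rewrite ?deg_le_sumX ?deg_le_nat.
by apply: deg_leM => //; apply: deg_leD; rewrite ?deg_le1.
Qed.

End Certificate.

(** * Degree estimates and the theorem *)

Section DegreeBound.
Variable R : realType.

(** Telescoping, from 1 / sqrt (k + 1) <= 2 (sqrt (k + 1) - sqrt k). *)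
Lemma sum_inv_sqrt_le k :
  \sum_(1 <= l < k.+1) (Num.sqrt l%:R)^-1 <= 2 * Num.sqrt k%:R :> R.
Proof.
elim: k => [|k IH]; first by rewrite big_geq // mulr_ge0 // sqrtr_ge0.
rewrite big_nat_recr //=; set x := Num.sqrt k.+1%:R; set y := Num.sqrt k%:R in IH *.
have x0 : 0 < x by rewrite sqrtr_gt0 ltr0n.
have y0 : 0 <= y by rewrite sqrtr_ge0.
have xy : x ^+ 2 = y ^+ 2 + 1 by rewrite !sqr_sqrtr ?ler0n // natr1.
have : x^-1 <= 2 * (x - y).
  rewrite -[x^-1]mul1r ler_pdivrMr //.
  have : 0 <= (x - y) ^+ 2 by rewrite sqr_ge0.
  nra.
lra.
Qed.

(** The least natural number exceeding sqrt (n / l), a degree large enough for the damper at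
    distance l. *)
Definition damping_degree (n l : nat) : nat :=
  (Num.truncn (Num.sqrt (n%:R / l%:R : R))).+1.

Lemma damping_degree_ge n l : (0 < l)%N ->
  n%:R <= (damping_degree n l)%:R ^+ 2 * l%:R :> R.
Proof.
move=> l0; rewrite -ler_pdivrMr ?ltr0n //.
rewrite -[leLHS]sqr_sqrtr ?divr_ge0 //; apply: lerXn2r; rewrite ?nnegrE ?sqrtr_ge0 //.
by apply: ltW; apply: truncnS_gt.
Qed.

(** As l <= n, sqrt (n / l) is at least 1, and the factor 2 absorbs the successor in
    [damping_degree]. *)
Lemma damping_degree_le n l : (0 < l <= n)%N ->
  (damping_degree n l)%:R <= 2 * Num.sqrt n%:R * (Num.sqrt l%:R)^-1 :> R.
Proof.
move=> /andP[l0 ln].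
have sE : Num.sqrt (n%:R / l%:R) = Num.sqrt n%:R * (Num.sqrt l%:R)^-1 :> R.
  by rewrite sqrtrM // sqrtrV.
have s1 : 1 <= Num.sqrt (n%:R / l%:R) :> R.
  rewrite -[leLHS]sqrtr1; apply: ler_wsqrtr.
  by rewrite ler_pdivlMr ?ltr0n // mul1r ler_nat.
rewrite -mulrA -sE /damping_degree -natr1.
have : (Num.truncn (Num.sqrt (n%:R / l%:R : R)))%:R <= Num.sqrt (n%:R / l%:R) :> R.
  by rewrite truncn_le sqrtr_ge0.
lra.
Qed.

Lemma sum_damping_degree_le n k : (k <= n)%N ->
  (\sum_(1 <= l < k.+1) damping_degree n l)%:R <= 4 * Num.sqrt (n * k)%:R :> R.
Proof.
move=> kn.
apply: (@le_trans _ _ (2 * Num.sqrt n%:R * \sum_(1 <= l < k.+1) (Num.sqrt l%:R)^-1)).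
  rewrite natr_sum mulr_sumr big_nat [leRHS]big_nat.
  apply: ler_sum => l /andP[l0 lk]; apply: damping_degree_le.
  by rewrite l0 /=; lia.
have := ler_wpM2l (mulr_ge0 (ler0n R 2) (sqrtr_ge0 n%:R)) (sum_inv_sqrt_le k).
by move/le_trans; apply; rewrite natrM sqrtrM // -subr_ge0; lra.
Qed.

End DegreeBound.

Theorem theorem1 (R : realType) :
  exists C : R, 0 < C /\
    forall n k : nat, (0 < n)%N -> (2 <= k)%N -> (k <= uphalf n)%N ->
      exists d : nat,
        d%:R <= C * Num.sqrt (n * k)%:R * ln (n%:R : R) /\
        has_SoS_certificate d (sos_q R n k).
Proof.
have ln2 : 0 < ln (2 : R) by rewrite ln_gt0 // ltr1n.
(* With s = sqrt (n k), L = log_2 n and A the sum of the damping degrees, the degree is 4 k + 6 + 2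
   P A. Here P <= 10 L, A <= 4 s and 2 <= k <= s <= s L, so the three terms are at most 4 s L, 3 s L
   and 80 s L. *)
exists (90 / ln 2); split; first by rewrite divr_gt0.
move=> n k _ k2 kn.
set s := Num.sqrt _; set L := ln (n%:R : R) / ln 2.
have -> : 90 / ln 2 * s * ln n%:R = 90 * (s * L) by rewrite /L; ring.
have n3 : (3 <= n)%N by lia.
have ln_le (x : nat) : (0 < x)%N -> (x <= n)%N -> ln (x%:R : R) <= ln n%:R.
  by move=> x0 xn; rewrite ler_ln ?posrE ?ltr0n ?ler_nat //; lia.
have L1 : 1 <= L by rewrite ler_pdivlMr // mul1r ln_le //; lia.
have sk : k%:R <= s.
  rewrite -[leLHS]ger0_norm // -sqrtr_sqr; apply: ler_wsqrtr.
  by rewrite -natrX ler_nat; nia.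
have k2R : 2 <= k%:R :> R by rewrite ler_nat.
have sL : s <= s * L by rewrite ler_peMr //; lra.
have [kn1|kn1] := ltnP k.+1 n; last first.
  have [-> ->] : n = 3%N /\ k = 2%N by lia.
  exists (2 * 4)%N; split; last exact: bool_sos_certificate (bool_sos_sos_q_3_2 R).
  by rewrite (_ : (2 * 4)%:R = 8 :> R) //; lra.
pose P := (5 * (trunc_log 2 n).+1)%N.
have hP : (n ^ 5 <= 2 ^ P)%N.
  rewrite /P mulnC expnM leq_exp2r //; apply: ltnW; exact: trunc_log_ltn.
have PL : P%:R <= 10 * L.
  have : (trunc_log 2 n)%:R <= L.
    rewrite /L ler_pdivlMr // mulr_natl -lnXn // -natrX; apply: ln_le.
      by rewrite expn_gt0.
    by apply: trunc_logP; lia.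
  rewrite /P natrM -natr1; lra.
clearbody P.
have hD l : (0 < l <= k)%N -> n%:R <= (damping_degree R n l)%:R ^+ 2 * l%:R :> R.
  by move=> /andP[l0 _]; apply: damping_degree_ge.
exists (2 * (k + P * \sum_(1 <= l < k.+1) damping_degree R n l + k.+1 + 2))%N.
split; last first.
  exact: bool_sos_certificate (bool_sos_sos_q R n k _ P k2 kn1 kn hD hP).
have kn' : (k <= n)%N by lia.
have hA := sum_damping_degree_le R n k kn'; rewrite -/s in hA.
rewrite natrM !natrD natrM -[k.+1%:R]natr1.
set A := (\sum_(1 <= l < k.+1) _)%N%:R in hA *.
have : P%:R * A <= 10 * L * (4 * s) by apply: ler_pM; rewrite ?ler0n.
have -> : 10 * L * (4 * s) = 40 * (s * L) by ring.
lra.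
Qed.
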